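(* Let $G$ be a $K_4$-free regular graph on $n$ vertices. If every vertex set $S\subseteq V(G)$ of size $\lfloor n/2\rfloor$ spans at least $n^2/18$ edges of $G$, then $n$ is divisible by $6$ and $G\cong T_3(n)$.
   Context: All graphs are finite and simple, with at least one vertex. A graph is $K_4$-free if it does not contain $K_4$ as a subgraph. A vertex set $S$ spans $m$ edges if the induced subgraph $G[S]$ has exactly $m$ edges. $T_3(n)$ denotes the Turán graph, i.e. the complete $3$-partite graph on $n$ vertices in which the sizes of every two parts differ by at most one. *)

(* Defs.v *)
From mathcomp Require Import all_boot all_order all_algebra.
From mathcomp Require Import zify.

Set Implicit Arguments.
Unset Strict Implicit.
Unset Printing Implicit Defensive.

Record sgraph := SGraph {
  vertex :> finType;
  adj : rel vertex;
  adj_sym : symmetric adj;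
  adj_irrefl : irreflexive adj }.

Definition edges (G : sgraph) : {set {set G}} :=
  [set [set p.1; p.2] | p : G * G & adj p.1 p.2].

Section Induced.
Variables (G : sgraph) (S : {set G}).

Definition induced_adj : rel {x : G | x \in S} := fun x y => adj (val x) (val y).

Lemma induced_sym : symmetric induced_adj.
Proof. by move=> x y; apply: adj_sym. Qed.

Lemma induced_irrefl : irreflexive induced_adj.
Proof. by move=> x; apply: adj_irrefl. Qed.

Definition induced : sgraph := SGraph induced_sym induced_irrefl.

End Induced.

Definition spanned_edges (G : sgraph) (S : {set G}) : nat :=
  #|edges (induced S)|.

Definition degree (G : sgraph) (x : G) : nat := #|[set y | adj x y]|.

Definition regular (G : sgraph) : Prop := exists d, forall x : G, degree x = d.

(* The complete multipartite graph whose parts are the fibres of [c]. *)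
Section CompleteMultipartite.
Variables (T : finType) (C : eqType) (c : T -> C).

Definition multipartite_adj : rel T := fun x y => c x != c y.

Lemma multipartite_sym : symmetric multipartite_adj.
Proof. by move=> x y; rewrite /multipartite_adj eq_sym. Qed.

Lemma multipartite_irrefl : irreflexive multipartite_adj.
Proof. by move=> x; rewrite /multipartite_adj eqxx. Qed.

Definition complete_multipartite : sgraph :=
  SGraph multipartite_sym multipartite_irrefl.

End CompleteMultipartite.

(* All parts are singletons. *)
Definition complete_graph (k : nat) : sgraph :=
  complete_multipartite (fun i : 'I_k => i).

(* The r parts (r > 0) are the residue classes mod r in {0, .., n-1}; their
   sizes differ by at most one, see [turan_balanced]. *)
Definition turan (r n : nat) : sgraph :=
  complete_multipartite (fun i : 'I_n => i %% r).

Lemma turan_balanced (r n a b : nat) : a < r -> b < r ->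
  #|[set i : 'I_n | i %% r == a]| <= #|[set i : 'I_n | i %% r == b]|.+1.
Proof.
move=> ar br; set A := [set i : 'I_n | _]; set B := [set i : 'I_n | _].
case: n @A @B => [|n] A B.
  by rewrite (leq_trans (max_card _)) // card_ord.
have [k Ak] : exists k : 'I_n.+1, forall i, i \in A -> i < r -> i = k.
  exists (inord a) => i; rewrite inE => /eqP ia ir.
  by rewrite -ia (modn_small ir) inord_val.
rewrite (cardsD1 k) -[#|B|.+1]add1n leq_add ?leq_b1 //.
pose f (i : 'I_n.+1) : 'I_n.+1 := inord (i - r - a + b).
have big (i : 'I_n.+1) : i \in A :\ k -> exists2 q, (i : nat) = q.+1 * r + a & i \in A.
  rewrite !inE => /andP[nik ia].
  have ri : r <= i.
    by case: leqP => // ir; rewrite (Ak i) ?eqxx // ?inE in nik.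
  exists (i %/ r).-1; last by rewrite ia.
  rewrite prednK ?divn_gt0 //; last by apply: leq_ltn_trans ar.
  by rewrite {1}(divn_eq i r) (eqP ia).
have fE (i : 'I_n.+1) q : (i : nat) = q.+1 * r + a -> f i = q * r + b :> nat.
  move=> iE; rewrite /f iE mulSn -addnA addKn addnK inordK //.
  by have := ltn_ord i; rewrite iE mulSn; lia.
rewrite -(card_in_imset (f := f)); last first.
  move=> i j /big[q iE _] /big[q' jE _] /(congr1 val) /=.
  rewrite (fE _ _ iE) (fE _ _ jE) => /eqP; rewrite eqn_add2r => /eqP qE.
  by apply: val_inj; rewrite /= iE jE !mulSn qE.
apply/subset_leq_card/subsetP => _ /imsetP[i /big[q iE _] ->].
by rewrite inE (fE _ _ iE) modnMDl modn_small.
Qed.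

(* G has a (not necessarily induced) subgraph isomorphic to H. *)
Definition contains (G H : sgraph) : Prop :=
  exists2 f : H -> G, injective f & forall x y, adj x y -> adj (f x) (f y).

Definition isomorphic (G H : sgraph) : Prop :=
  exists2 f : G -> H, bijective f & forall x y, adj (f x) (f y) = adj x y.

(* Main.v *)
Require Import Defs.
From mathcomp Require Import all_boot all_order all_algebra.
From mathcomp Require Import ring lra zify.

(* Write d for the degree.  Rounding shows that the hypothesis implies
   its fractional version: every weight function w with values in [0, 1] and total
   weight n / 2 spans at least n ^ 2 / 18, so that the adjacency form satisfies
   y A y >= 4 n ^ 2 / 9 - n d for every y with values in [-1, 1] and sum 0.

   Applied to suitable weights on a neighbourhood N(u), this bounds from below the
   mean codegree t_u of u with its neighbours, by n ^ 2 / (9 (n - d)) if 2 d >= n.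
   Applied to 1_N(u) - 1_N(v) for an edge uv of a triangle uvw, with the edges
   between N(u) \ N(v) and N(v) \ N(u) estimated through the independent sets
   N(u) \cap N(w) and N(v) \cap N(w), and summed over all triangles, it gives
     sum_u t_u (16 t_u ^ 2 - (27 d - 8 n) t_u + 10 d ^ 2 - 5 d n + 4 n ^ 2 / 9) <= 0,
   whereas every summand is positive when d < 2 n / 3.  Hence d = 2 n / 3, where
   non-adjacency is an equivalence relation with classes of size n / 3. *)

Set Implicit Arguments.
Unset Strict Implicit.
Unset Printing Implicit Defensive.

Import Order.TTheory GRing.Theory Num.Theory.
Local Open Scope ring_scope.

(** * The adjacency form on vertex weights *)

Section Weights.
Variable R : realFieldType.

Definition nbr (G : sgraph) (x y : G) : R := (adj x y)%:R.

Definition indic (T : finType) (S : {set T}) (x : T) : R := (x \in S)%:R.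

(** The sum runs over ordered pairs, so the form of an indicator counts every spanned edge twice. *)
Definition qform (G : sgraph) (f g : G -> R) : R :=
  \sum_x \sum_y f x * g y * nbr x y.

Lemma nbrC (G : sgraph) (x y : G) : nbr x y = nbr y x.
Proof. by rewrite /nbr adj_sym. Qed.

Lemma nbr01 (G : sgraph) (x y : G) : 0 <= nbr x y <= 1.
Proof. by rewrite /nbr; case: adj; rewrite ?lexx ?ler01. Qed.

Lemma nbrxx (G : sgraph) (x : G) : nbr x x = 0.
Proof. by rewrite /nbr adj_irrefl. Qed.

Lemma qformC (G : sgraph) (f g : G -> R) : qform f g = qform g f.
Proof.
rewrite /qform exchange_big /=; apply: eq_bigr => y _; apply: eq_bigr => x _.
by rewrite nbrC (mulrC (f _)).
Qed.

Lemma qform_lin (G : sgraph) (f f1 f2 g : G -> R) (a b : R) :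
  (forall x, f x = a * f1 x + b * f2 x) ->
  qform f g = a * qform f1 g + b * qform f2 g.
Proof.
move=> fE; rewrite /qform !mulr_sumr -big_split /=; apply: eq_bigr => x _.
rewrite !mulr_sumr -big_split /=; apply: eq_bigr => y _; rewrite fE; ring.
Qed.

Lemma qform_add (G : sgraph) (f f1 f2 g : G -> R) :
  (forall x, f x = f1 x + f2 x) -> qform f g = qform f1 g + qform f2 g.
Proof. by move=> fE; rewrite (@qform_lin _ f f1 f2 g 1 1) ?mul1r // => x; rewrite !mul1r. Qed.

Lemma qform_addr (G : sgraph) (f f1 f2 g : G -> R) :
  (forall x, f x = f1 x + f2 x) -> qform g f = qform g f1 + qform g f2.
Proof. by move=> fE; rewrite ![qform g _]qformC (qform_add _ fE). Qed.

Lemma qform_sqr (G : sgraph) (f f1 f2 : G -> R) (a b : R) :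
  (forall x, f x = a * f1 x + b * f2 x) ->
  qform f f = a ^+ 2 * qform f1 f1 + 2 * a * b * qform f1 f2 + b ^+ 2 * qform f2 f2.
Proof.
move=> fE; rewrite (qform_lin _ fE) ![qform _ f]qformC !(qform_lin _ fE).
rewrite (qformC f2 f1); ring.
Qed.

Lemma qform_le (G : sgraph) (f f' g g' : G -> R) :
  (forall x, 0 <= f x <= f' x) -> (forall x, 0 <= g x <= g' x) ->
  qform f g <= qform f' g'.
Proof.
move=> ff' gg'; apply: ler_sum => x _; apply: ler_sum => y _.
have /andP[f0 lef] := ff' x; have /andP[g0 leg] := gg' y.
have /andP[n0 _] := nbr01 x y.
by apply: ler_wpM2r => //; apply: ler_pM.
Qed.

Lemma qform_ge0 (G : sgraph) (f g : G -> R) :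
  (forall x, 0 <= f x) -> (forall x, 0 <= g x) -> 0 <= qform f g.
Proof.
move=> f0 g0; apply: sumr_ge0 => x _; apply: sumr_ge0 => y _.
by rewrite !mulr_ge0 //; have /andP[] := nbr01 x y.
Qed.

Lemma qform_le_mul (G : sgraph) (f g : G -> R) :
  (forall x, 0 <= f x) -> (forall x, 0 <= g x) ->
  qform f g <= (\sum_x f x) * (\sum_x g x).
Proof.
move=> f0 g0; rewrite mulr_suml; apply: ler_sum => x _; rewrite mulr_sumr.
apply: ler_sum => y _; have /andP[n0 n1] := nbr01 x y.
by rewrite ler_piMr // mulr_ge0.
Qed.

(** * Point masses and the rounding of fractional weights *)

Definition delta (G : sgraph) (i : G) (x : G) : R := (x == i)%:R.

Lemma qform_delta (G : sgraph) (f : G -> R) (i : G) :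
  qform f (delta i) = \sum_x f x * nbr x i.
Proof.
apply: eq_bigr => x _; rewrite (bigD1 i) //= big1 => [|y /negPf yi].
  by rewrite /delta eqxx mulr1 addr0.
by rewrite /delta yi mulr0 mul0r.
Qed.

Lemma sum_delta (G : sgraph) (f : G -> R) (i : G) : \sum_x delta i x * f x = f i.
Proof.
rewrite (bigD1 i) //= big1 => [|y /negPf yi]; first by rewrite /delta eqxx mul1r addr0.
by rewrite /delta yi mul0r.
Qed.

Lemma sum_indic (T : finType) (S : {set T}) : \sum_x indic S x = #|S|%:R.
Proof.
rewrite (bigID (mem S)) /= [X in _ + X]big1 => [|x /negPf xS]; last by rewrite /indic xS.
rewrite addr0 (eq_bigr (fun=> 1)) => [|x xS]; last by rewrite /indic xS.
by rewrite sumr_const.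
Qed.

(* Moving weight between two fractional vertices changes the form by a concave
   function of the amount moved, so one of the two directions does not increase it. *)
Lemma round_weights (G : sgraph) (w : G -> R) :
  (forall x, 0 <= w x <= 1) ->
  exists S : {set G}, [/\ #|S|%:R <= \sum_x w x, \sum_x w x < #|S|%:R + 1
    & qform (indic S) (indic S) <= qform w w].
Proof.
pose frac (w : G -> R) := [set x | (w x != 0) && (w x != 1)].
move: {2}#|frac w|.+1 (ltnSn #|frac w|) => k; elim: k w => // k IHk w frack w01.
(* If at most one vertex is fractional, it is rounded down to 0. *)
have [frac1|] := leqP #|frac w| 1.
  pose S := [set x | w x == 1]; exists S.
  have Sw x : 0 <= indic S x <= w x.
    rewrite /indic inE; case: eqP => [->|_]; first by rewrite ler01 lexx.
    by have /andP[-> _] := w01 x; rewrite lexx.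
  have -> : \sum_x w x = #|S|%:R + \sum_(x in frac w) w x.
    rewrite -sum_indic [X in _ = _ + X]big_mkcond -big_split /=; apply: eq_bigr => x _.
    rewrite /indic !inE; case: (eqVneq (w x) 1) => [->|_]; first by rewrite andbF addr0.
    by rewrite andbT add0r; case: eqVneq => [->|_].
  split; [| |exact: qform_le]; first by rewrite lerDl sumr_ge0 // => x _; have /andP[] := w01 x.
  rewrite ltrD2l; move: frac1; rewrite leq_eqVlt ltnS leqn0.
  case/orP => [/cards1P[i ti]|/eqP/cards0_eq->]; last by rewrite big_set0.
  rewrite ti big_set1; have : i \in frac w by rewrite ti set11.
  by rewrite inE lt_neqAle => /andP[_ ->]; have /andP[_ ->] := w01 i.
move=> /card_gt1P[i0 [j0 [i0f j0f i0j0]]].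
have [i [j [fi fj ij Lij]]] : exists i j, [/\ i \in frac w, j \in frac w, i != j
    & qform w (delta i) <= qform w (delta j)].
  have [le|/ltW le] := leP (qform w (delta i0)) (qform w (delta j0)).
    by exists i0, j0.
  by exists j0, i0; rewrite eq_sym.
(* The largest amount that can move from [j] to [i]: it brings one of the two weights to an end of
   [0, 1], so [frac] shrinks. *)
pose t := Num.min (1 - w i) (w j).
have [wi0 wi1] := andP (w01 i); have [wj0 wj1] := andP (w01 j).
have t0 : 0 <= t by rewrite le_min wj0 subr_ge0 wi1.
have [ti tj] : t <= 1 - w i /\ t <= w j by rewrite !ge_min !lexx orbT.
pose e x := delta i x - delta j x; pose w' x := w x + t * e x.
have w'E x : w' x = if x == i then w i + t else if x == j then w j - t else w x.
  rewrite /w' /e /delta; case: eqVneq => [->|_]; first by rewrite (negPf ij) /=; ring.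
  by case: eqVneq => [->|_] /=; ring.
have w'01 x : 0 <= w' x <= 1.
  by rewrite w'E; case: eqP => _; [lra|case: eqP => _; [lra|exact: w01]].
have w'k : (#|frac w'| < k)%N.
  rewrite -ltnS; apply: leq_trans frack; rewrite ltnS; apply: proper_card.
  apply/properP; split.
    apply/subsetP => x; rewrite !inE w'E.
    case: (eqVneq x i) => [->|_]; first by rewrite inE in fi.
    by case: (eqVneq x j) => [->|_] //; rewrite inE in fj.
  have : t = 1 - w i \/ t = w j by rewrite /t minEle; case: ifP; [left|right].
  case=> tE; [exists i|exists j] => //; rewrite inE w'E ?eqxx tE.
    by have -> : w i + (1 - w i) = 1 by [ring]; rewrite eqxx andbF.
  by rewrite (eq_sym j i) (negPf ij) subrr eqxx.
have sumE : \sum_x w' x = \sum_x w x.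
  have sd k0 : \sum_x delta k0 x = 1 :> R.
    by rewrite -(sum_delta (fun=> 1) k0); apply: eq_bigr => x _; rewrite mulr1.
  by rewrite big_split /= -mulr_sumr sumrB !sd subrr mulr0 addr0.
have [S [S1 S2 S3]] := IHk w' w'k w'01.
exists S; rewrite -sumE; split=> //; apply: le_trans S3 _.
rewrite (@qform_sqr _ w' w e 1 t) => [|x]; last by rewrite mul1r.
have wE f : qform e f = qform (delta i) f - qform (delta j) f.
  rewrite (@qform_lin _ e (delta i) (delta j) f 1 (- 1)); first ring.
  by move=> x; rewrite /e; ring.
have dd k1 k2 : qform (delta k1) (delta k2) = nbr k1 k2.
  by rewrite qform_delta sum_delta.
have := nbr01 i j; have := nbrC i j; have := nbrxx i; have := nbrxx j.
rewrite wE 2!(qformC (delta _) e) (qformC w e) !wE !dd !(qformC _ w) => -> -> <- /andP[n0 _].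
(* The form changes by [2 * t * (qform w (delta i) - qform w (delta j)) - 2 * t ^+ 2 * nbr i j], and
   both terms are at most 0. *)
have : 0 <= t * (qform w (delta j) - qform w (delta i)) by rewrite mulr_ge0 ?subr_ge0.
have : 0 <= t ^+ 2 * nbr i j by rewrite mulr_ge0 ?sqr_ge0.
lra.
Qed.

(** * Spanned edges and the form of an indicator *)

Lemma card_edges (H : sgraph) :
  (2 * #|edges H| <= #|[set p : H * H | adj p.1 p.2]|)%N.
Proof.
rewrite /edges; set P := [set p | _]; set f := fun p : H * H => _.
rewrite -[#|P|]sum1_card (partition_big_imset f) /= -[#|f @: P|]sum1_card big_distrr /=.
apply: leq_sum => e /imsetP[[x y]]; rewrite inE /= => xy ->.
have xy' : x != y by apply: contraTneq xy => ->; rewrite adj_irrefl.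
(* The fibre over an edge contains the two distinct pairs (x, y) and (y, x). *)
rewrite (bigD1 (x, y)) /=; last by rewrite inE /= xy eqxx.
rewrite (bigD1 (y, x)) /= ?leq_addr // inE /= adj_sym xy /f /= setUC eqxx /=.
by rewrite xpair_eqE eq_sym (negPf xy').
Qed.

Lemma spanned_edges_qform (G : sgraph) (S : {set G}) :
  (spanned_edges S)%:R * 2 <= qform (indic S) (indic S).
Proof.
pose P := [set p : G * G | [&& p.1 \in S, p.2 \in S & adj p.1 p.2]].
have -> : qform (indic S) (indic S) = #|P|%:R.
  rewrite -sum_indic /qform pair_bigA /=; apply: eq_bigr => -[x y] _.
  by rewrite /indic /nbr inE /= -!natrM !mulnb andbA.
rewrite -natrM ler_nat mulnC; apply: leq_trans (card_edges _) _.
pose f (p : induced S * induced S) := (val p.1, val p.2).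
rewrite -(card_imset _ (f := f)); last first.
  by move=> [x y] [x' y'] [/val_inj -> /val_inj ->].
apply/subset_leq_card/subsetP => q /imsetP[[x y]]; rewrite inE /= => xy ->.
by rewrite inE /= (valP x) (valP y); exact: xy.
Qed.

(** * Codegrees in regular and K4-free graphs *)

Definition codeg (G : sgraph) (u v : G) : R := \sum_x nbr u x * nbr v x.

(* Counts ordered pairs: twice the number of edges inside N(u). *)
Definition local_edges (G : sgraph) (u : G) : R := \sum_x nbr u x * codeg u x.

(** For adjacent [u] and [v], this counts the walks of length two from [v] in the graph induced on
    N(u). *)
Definition local_walks (G : sgraph) (u v : G) : R :=
  \sum_x nbr u x * nbr v x * codeg u x.

Definition regular_of (G : sgraph) (d : R) : Prop :=
  forall x : G, \sum_y nbr x y = d.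

Definition K4_free (G : sgraph) : Prop :=
  forall u v w x : G, adj u v -> adj u w -> adj v w -> adj u x -> adj v x -> ~~ adj w x.

Lemma K4_free_nbr (G : sgraph) (u v w x : G) :
  K4_free G -> adj u v -> adj u w -> adj v w -> nbr u x * nbr v x * nbr w x = 0.
Proof.
move=> K4 uv uw vw; have := K4 _ _ _ x uv uw vw; rewrite /nbr.
case: (adj u x); last by rewrite !mul0r.
case: (adj v x); last by rewrite mulr0 mul0r.
by move=> /(_ isT isT)/negPf->; rewrite mulr0.
Qed.

(** The threshold is twice n^2/18 because [qform] counts ordered pairs. The total weight is exactly
    n/2, for odd n too. *)
Definition locally_dense (G : sgraph) : Prop :=
  forall w : G -> R, (forall x, 0 <= w x <= 1) -> \sum_x w x = #|G|%:R / 2 ->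
    #|G|%:R ^+ 2 / 9 <= qform w w.

Lemma codegC (G : sgraph) (u v : G) : codeg u v = codeg v u.
Proof. by apply: eq_bigr => x _; rewrite mulrC. Qed.

Lemma codeg_ge0 (G : sgraph) (u v : G) : 0 <= codeg u v.
Proof.
apply: sumr_ge0 => x _; have /andP[ux _] := nbr01 u x.
by have /andP[vx _] := nbr01 v x; rewrite mulr_ge0.
Qed.

Lemma qform_nbr (G : sgraph) (f : G -> R) (u : G) :
  qform f (nbr u) = \sum_x f x * codeg u x.
Proof.
apply: eq_bigr => x _; rewrite mulr_sumr; apply: eq_bigr => y _.
by rewrite mulrA.
Qed.

Lemma qform_const (G : sgraph) (d : R) (f : G -> R) :
  regular_of G d -> qform f (fun=> 1) = d * \sum_x f x.
Proof.
move=> reg; rewrite mulr_sumr; apply: eq_bigr => x _.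
rewrite (eq_bigr (fun y => f x * nbr x y)) => [|y _]; last by rewrite mulr1.
by rewrite -mulr_sumr reg mulrC.
Qed.

Lemma sum_const1 (T : finType) : \sum_(x : T) 1 = #|T|%:R :> R.
Proof. by rewrite sumr_const. Qed.

Lemma codeg_ge (G : sgraph) (d : R) (u v : G) :
  regular_of G d -> 2 * d - #|G|%:R <= codeg u v.
Proof.
move=> reg; have : 0 <= \sum_x (1 - nbr u x) * (1 - nbr v x).
  apply: sumr_ge0 => x _; have /andP[_ ux] := nbr01 u x.
  by have /andP[_ vx] := nbr01 v x; rewrite mulr_ge0 ?subr_ge0.
rewrite (eq_bigr (fun x => 1 - nbr u x - nbr v x + nbr u x * nbr v x)); last first.
  by move=> x _; ring.
rewrite big_split /= !sumrB sum_const1 !reg -/(codeg u v); lra.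
Qed.

Lemma codeg_gt0 (G : sgraph) (u v w : G) : adj u w -> adj v w -> 1 <= codeg u v.
Proof.
move=> uw vw; rewrite /codeg (bigD1 w) //= {1 2}/nbr uw vw mulr1 lerDl.
apply: sumr_ge0 => x _; have /andP[ux _] := nbr01 u x.
by have /andP[vx _] := nbr01 v x; rewrite mulr_ge0.
Qed.

(** An edge inside N(u) \cap N(v) would complete a K4 with the edge uv. *)
Lemma codeg_indep (G : sgraph) (u v : G) : K4_free G -> adj u v ->
  qform (fun x => nbr u x * nbr v x) (fun x => nbr u x * nbr v x) = 0.
Proof.
move=> K4 uv; apply: big1 => x _; apply: big1 => y _.
have -> : nbr u x * nbr v x * (nbr u y * nbr v y) * nbr x y
  = nbr u x * nbr v x * (nbr u y * nbr v y * nbr x y) by ring.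
have [ux|/negPf ux] := boolP (adj u x); last by rewrite {1}/nbr ux !mul0r.
have [vx|/negPf vx] := boolP (adj v x); last by rewrite {2}/nbr vx mulr0 mul0r.
by rewrite K4_free_nbr ?mulr0.
Qed.

(** N(u) \cap N(v) and N(u) \cap N(w) are disjoint subsets of N(u), since a common element would
    give a K4. *)
Lemma triangle_codeg (G : sgraph) (d : R) (u v w : G) :
  regular_of G d -> K4_free G -> adj u v -> adj u w -> adj v w ->
  codeg u v + codeg u w <= d.
Proof.
move=> reg K4 uv uw vw; have : 0 <= \sum_x nbr u x * (1 - nbr v x) * (1 - nbr w x).
  apply: sumr_ge0 => x _; have /andP[ux _] := nbr01 u x.
  have /andP[_ vx] := nbr01 v x; have /andP[_ wx] := nbr01 w x.
  by rewrite !mulr_ge0 ?subr_ge0.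
rewrite (eq_bigr (fun x => nbr u x - nbr u x * nbr v x - nbr u x * nbr w x)); last first.
  by move=> x _; have := K4_free_nbr x K4 uv uw vw; lra.
rewrite !sumrB reg -/(codeg u v) -/(codeg u w); lra.
Qed.

(** * Density tested on signed weights, and the inequality at a triangle *)

(** The weight (1 + y) / 2 has total n/2. By regularity its cross term is a multiple of the sum of
    [y], which vanishes. *)
Lemma dense_signed (G : sgraph) (d : R) (y : G -> R) :
  regular_of G d -> locally_dense G -> (forall x, -1 <= y x <= 1) ->
  \sum_x y x = 0 -> 4 / 9 * #|G|%:R ^+ 2 - #|G|%:R * d <= qform y y.
Proof.
move=> reg dns y01 y0; pose w x := 1 / 2 * y x + 1 / 2 * 1.
have wE : qform w w = 1 / 4 * (qform y y + #|G|%:R * d).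
  rewrite (@qform_sqr _ w y (fun=> 1) (1 / 2) (1 / 2)) // !(qform_const _ reg).
  by rewrite y0 sum_const1; field.
have : \sum_x w x = #|G|%:R / 2.
  by rewrite big_split /= -!mulr_sumr y0 sum_const1; field.
have w01 x : 0 <= w x <= 1 by have := y01 x; rewrite /w; lra.
by move/(dns w w01); rewrite wE; lra.
Qed.

(** The test vector 1_N(u) - 1_N(v) lives on B = N(u) \ N(v) and C = N(v) \ N(u). As N(u) \cap N(v)
    is independent, the forms of B and C are known exactly; it remains to bound the edges between B
    and C from below. *)
Lemma triangle_bound (G : sgraph) (d : R) (u v w : G) :
  regular_of G d -> K4_free G -> locally_dense G ->
  adj u v -> adj u w -> adj v w ->
  2 * (local_walks w u + local_walks w v) + 4 * (local_walks u v + local_walks v u)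
  + 2 * (local_walks u w + local_walks v w)
  - local_edges w - 3 * (local_edges u + local_edges v)
  + 2 * ((2 * d - 2 * codeg u v - codeg u w - codeg v w)
         * (3 * d - #|G|%:R - codeg u v)
         - (d - codeg u v - codeg u w) * (d - codeg u v - codeg v w))
  <= #|G|%:R * d - 4 / 9 * #|G|%:R ^+ 2.
Proof.
move=> reg K4 dns uv uw vw; set n := #|G|%:R.
have vu : adj v u by rewrite adj_sym.
pose U := nbr u; pose V := nbr v; pose W := nbr w.
have K x : U x * V x * W x = 0 by exact: K4_free_nbr.
have U01 x : 0 <= U x <= 1 := nbr01 u x.
have V01 x : 0 <= V x <= 1 := nbr01 v x.
have W01 x : 0 <= W x <= 1 := nbr01 w x.
(* [I], [P], [Q] are the pairwise common neighbourhoods, all independent; [RU] and [RV] are what [P]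
   and [Q] leave of [B] and [C], and [D] is the set of common non-neighbours of [u] and [v]. *)
pose I x := U x * V x; pose P x := U x * W x; pose Q x := V x * W x.
pose B x := U x * (1 - V x); pose C x := V x * (1 - U x).
pose RU x := U x * (1 - V x) * (1 - W x); pose RV x := V x * (1 - U x) * (1 - W x).
pose D x := (1 - U x) * (1 - V x).
have I0 : qform I I = 0 by exact: codeg_indep.
have P0 : qform P P = 0 by exact: codeg_indep.
have Q0 : qform Q Q = 0 by exact: codeg_indep.
have UE x : U x = I x + B x by rewrite /I /B; ring.
have VE x : V x = I x + C x by rewrite /I /C; ring.
have BE x : B x = P x + RU x by have := K x; rewrite /B /P /RU; lra.
have CE x : C x = Q x + RV x by have := K x; rewrite /C /Q /RV; lra.
have BEB : qform B B = local_edges u - 2 * local_walks u v.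
  have : qform I U = qform I I + qform I B by exact: qform_addr.
  have : qform U U = qform I U + qform B U by exact: qform_add.
  have : qform B U = qform I B + qform B B by rewrite (qformC I) (qform_addr _ UE).
  by rewrite !qform_nbr I0 -/(local_edges u) -/(local_walks u v); lra.
have CEC : qform C C = local_edges v - 2 * local_walks v u.
  have : qform I V = qform I I + qform I C by exact: qform_addr.
  have : qform V V = qform I V + qform C V by exact: qform_add.
  have : qform C V = qform I C + qform C C by rewrite (qformC I) (qform_addr _ VE).
  have : qform I V = local_walks v u.
    by rewrite qform_nbr; apply: eq_bigr => x _; rewrite /I (mulrC (U x)).
  by rewrite !qform_nbr I0 -/(local_edges v); lra.
have PQ : local_walks w u + local_walks w v - 1 / 2 * local_edges w <= qform P Q.
  (* [Z] is the indicator of N(w) without [P] and [Q]. Its form is nonnegative, which bounds the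
     edges between [P] and [Q] from below. *)
  pose Z x := 1 * (1 * W x + - 1 * P x) + - 1 * Q x.
  have ZE : qform Z Z = local_edges w - 2 * local_walks w u - 2 * local_walks w v
      + 2 * qform P Q.
    rewrite (@qform_sqr _ Z (fun x => 1 * W x + - 1 * P x) Q 1 (- 1)) //.
    rewrite (@qform_lin _ _ W P Q 1 (- 1)) // (@qform_sqr _ _ W P 1 (- 1)) //.
    rewrite P0 Q0 (qformC W P) (qformC W Q) !qform_nbr.
    have -> : \sum_x P x * codeg w x = local_walks w u.
      by apply: eq_bigr => x _; rewrite /P (mulrC (U x)).
    have -> : \sum_x Q x * codeg w x = local_walks w v.
      by apply: eq_bigr => x _; rewrite /Q (mulrC (V x)).
    by rewrite -/(local_edges w); ring.
  have Z0 x : 0 <= Z x.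
    have -> : Z x = W x * (1 - U x) * (1 - V x) by have := K x; rewrite /Z /P /Q; lra.
    have := U01 x; have := V01 x; have /andP[W0 _] := W01 x => vx ux.
    by rewrite !mulr_ge0 //; lra.
  by have := qform_ge0 Z0 Z0; rewrite ZE; lra.
have RUU : qform RU U = local_edges u - local_walks u v - local_walks u w.
  have : qform U U = qform I U + (qform P U + qform RU U).
    by rewrite (qform_add _ UE) (qform_add _ BE).
  by rewrite !qform_nbr -/(local_edges u) -/(local_walks u v) -/(local_walks u w); lra.
have RVV : qform RV V = local_edges v - local_walks v u - local_walks v w.
  have : qform V V = qform I V + (qform Q V + qform RV V).
    by rewrite (qform_add _ VE) (qform_add _ CE).
  have : qform I V = local_walks v u.
    by rewrite qform_nbr; apply: eq_bigr => x _; rewrite /I (mulrC (U x)).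
  by rewrite !qform_nbr -/(local_edges v) -/(local_walks v w); lra.
have RU0 x : 0 <= RU x.
  have := U01 x; have := V01 x; have := W01 x => wx vx ux.
  by rewrite /RU !mulr_ge0 //; lra.
have RV0 x : 0 <= RV x.
  have := U01 x; have := V01 x; have := W01 x => wx vx ux.
  by rewrite /RV !mulr_ge0 //; lra.
have D0 x : 0 <= D x.
  have := U01 x; have := V01 x => vx ux.
  by rewrite /D mulr_ge0 //; lra.
have sRU : \sum_x RU x = d - codeg u v - codeg u w.
  rewrite (eq_bigr (fun x => U x - U x * V x - U x * W x)) => [|x _]; last first.
    by have := K x; rewrite /RU; lra.
  by rewrite !sumrB reg.
have sRV : \sum_x RV x = d - codeg u v - codeg v w.
  rewrite (eq_bigr (fun x => V x - U x * V x - V x * W x)) => [|x _]; last first.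
    by have := K x; rewrite /RV; lra.
  by rewrite !sumrB reg.
have sD : \sum_x D x = n - 2 * d + codeg u v.
  rewrite (eq_bigr (fun x => 1 - U x - V x + U x * V x)) => [|x _]; last first.
    by rewrite /D; ring.
  by rewrite big_split /= !sumrB !reg sum_const1 -/n -/(codeg u v); ring.
(* Each of the d edges at a vertex of [RU] ends in N(u), [C] or [D]. The edges to N(u) are known and
   those to [D] are at most the product of the sizes, which bounds [qform RU C] from below. *)
have RUC : qform RU (fun=> 1) = qform RU U + (qform RU C + qform RU D).
  have E1 x : 1 = U x + (C x + D x) by rewrite /C /D; ring.
  by rewrite (qform_addr _ E1); congr (_ + _); apply: qform_addr.
have RVB : qform RV (fun=> 1) = qform RV V + (qform RV B + qform RV D).
  have E1 x : 1 = V x + (B x + D x) by rewrite /B /D; ring.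
  by rewrite (qform_addr _ E1); congr (_ + _); apply: qform_addr.
(* Edges between [RU] and [RV] occur in both [qform RV B] and [qform RU C], hence the
   subtraction. *)
have BC : qform B C = qform P Q + qform RV B - qform RU RV + qform RU C.
  by rewrite (qform_add _ BE) (qform_addr _ CE) (qformC RV B) (qform_add RV BE); ring.
have := qform_le_mul RU0 RV0; have := qform_le_mul RU0 D0; have := qform_le_mul RV0 D0.
rewrite !(qform_const _ reg) in RUC RVB; rewrite RUU in RUC; rewrite RVV in RVB.
rewrite sRU sRV sD in RUC RVB * => RVD RUD RUV.
pose y x := 1 * B x + - 1 * C x.
have yE x : y x = U x - V x by rewrite /y /B /C; ring.
have y01 x : -1 <= y x <= 1.
  by rewrite yE; have := U01 x; have := V01 x; lra.
have y0 : \sum_x y x = 0.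
  by rewrite (eq_bigr _ (fun x _ => yE x)) sumrB !reg subrr.
have := dense_signed reg dns y01 y0.
rewrite (@qform_sqr _ y B C 1 (- 1)) // BEB CEC -/n => yy.
lra.
Qed.

(** * Summation over triangles *)

(** With [3 * (x + y)] in place of [a] the expression is a positive combination of two squares, and
    [a] is at least that large. *)
Lemma codeg_quad_ge0 (a d x y xi eta : R) :
  1 <= x -> 1 <= y -> x + y <= d -> 3 * d <= a ->
  0 <= 14 * xi * eta + xi ^+ 2 + eta ^+ 2 + a * (xi ^+ 2 / x + eta ^+ 2 / y).
Proof.
move=> x1 y1 xy ad; have x0 : x != 0 by lra.
have y0 : y != 0 by lra.
pose q := xi ^+ 2 / x + eta ^+ 2 / y.
have q0 : 0 <= q by rewrite addr_ge0 // divr_ge0 ?sqr_ge0 //; lra.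
have qE : 14 * xi * eta + xi ^+ 2 + eta ^+ 2 + 3 * (x + y) * q
    = 4 * (xi + eta) ^+ 2 + 3 * ((y * xi + x * eta) ^+ 2 / (x * y)).
  by rewrite /q; field; rewrite x0 y0.
have : 0 <= (y * xi + x * eta) ^+ 2 / (x * y).
  by rewrite divr_ge0 ?sqr_ge0 // mulr_ge0; lra.
have : 0 <= (a - 3 * (x + y)) * q by rewrite mulr_ge0 //; lra.
have := sqr_ge0 (xi + eta); rewrite -/q; lra.
Qed.

Definition triangle (G : sgraph) (u v w : G) : R :=
  nbr u v * nbr u w * nbr v w.

(** Every triangle occurs in all six orders, so the roles of [u], [v] and [w] may be permuted under
    the sum. *)
Definition tsum (G : sgraph) (F : G -> G -> G -> R) : R :=
  \sum_u \sum_v \sum_w triangle u v w * F u v w.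

Lemma triangle_ge0 (G : sgraph) (u v w : G) : 0 <= triangle u v w.
Proof. by rewrite /triangle /nbr -!natrM. Qed.

Lemma triangle_adj (G : sgraph) (u v w : G) :
  triangle u v w != 0 -> [/\ adj u v, adj u w & adj v w].
Proof.
rewrite /triangle /nbr; case: (adj u v); last by rewrite !mul0r eqxx.
case: (adj u w); last by rewrite mulr0 mul0r eqxx.
by case: (adj v w); rewrite ?mulr0 ?eqxx.
Qed.

Lemma triangle_sum (G : sgraph) (u : G) (f : G -> R) :
  \sum_v \sum_w triangle u v w * f v = \sum_v nbr u v * codeg u v * f v.
Proof.
apply: eq_bigr => v _; rewrite -mulr_suml; congr (_ * _).
by rewrite mulr_sumr; apply: eq_bigr => w _; rewrite mulrA.
Qed.

Lemma triangle_sumr (G : sgraph) (u : G) (f : G -> R) :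
  \sum_v \sum_w triangle u v w * f w = \sum_v nbr u v * codeg u v * f v.
Proof.
rewrite -triangle_sum exchange_big /=; apply: eq_bigr => w _; apply: eq_bigr => v _.
by rewrite /triangle (nbrC w v); ring.
Qed.

(* A first-order expansion at the mean [t] of the codegrees: the linear term
   contributes [a] times their variance, which [codeg_quad_ge0] shows to outweigh
   the indefinite quadratic term. *)
Lemma vertex_bound (G : sgraph) (d b t : R) (u : G) :
  regular_of G d -> K4_free G -> local_edges u = d * t -> 0 < d -> 0 <= t ->
  3 * d <= 16 * t - b ->
  local_edges u * (16 * t ^+ 2 - 2 * b * t) <=
  \sum_v \sum_w triangle u v w * (14 * codeg u v * codeg u w + codeg u v ^+ 2
     + codeg u w ^+ 2 - b * (codeg u v + codeg u w)).
Proof.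
move=> reg K4 gE d0 t0; have [a aE] : exists a, a = 16 * t - b by exists (16 * t - b).
rewrite -aE => ad.
(* [a] is the partial derivative of the summand where both codegrees equal [t]. The edge uv carries
   weight [codeg u v], which cancels the denominator: the bracket becomes [t * codeg u v - t ^+ 2],
   whose sum over N(u) is 0. *)
pose f v := a * ((codeg u v - t) - (codeg u v - t) ^+ 2 / codeg u v)
  + (8 * t ^+ 2 - b * t).
have le1 : \sum_v \sum_w triangle u v w * (f v + f w) <=
    \sum_v \sum_w triangle u v w * (14 * codeg u v * codeg u w + codeg u v ^+ 2
     + codeg u w ^+ 2 - b * (codeg u v + codeg u w)).
  apply: ler_sum => v _; apply: ler_sum => w _.
  have [->|tri0] := eqVneq (triangle u v w) 0; first by rewrite !mul0r.
  have [uv uw vw] := triangle_adj tri0; apply: ler_wpM2l; first exact: triangle_ge0.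
  have x1 : 1 <= codeg u v by exact: (codeg_gt0 uw vw).
  have y1 : 1 <= codeg u w by apply: (codeg_gt0 uv); rewrite adj_sym.
  have xy := triangle_codeg reg K4 uv uw vw.
  have := codeg_quad_ge0 (codeg u v - t) (codeg u w - t) x1 y1 xy ad.
  rewrite /f; move: (codeg u v) (codeg u w) => x y le0.
  rewrite -subr_ge0; apply: le_trans le0 _.
  by rewrite le_eqVlt aE; apply/orP; left; apply/eqP; ring.
apply: le_trans le1.
have -> : \sum_v \sum_w triangle u v w * (f v + f w)
    = \sum_v nbr u v * codeg u v * f v + \sum_v nbr u v * codeg u v * f v.
  rewrite -{1}triangle_sum -triangle_sumr -big_split; apply: eq_bigr => v _ /=.
  by rewrite -big_split; apply: eq_bigr => w _ /=; rewrite mulrDr.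
have : \sum_v (a * t * (nbr u v * codeg u v) - a * t ^+ 2 * nbr u v
     + (8 * t ^+ 2 - b * t) * (nbr u v * codeg u v))
   <= \sum_v nbr u v * codeg u v * f v.
  apply: ler_sum => v _; have /andP[n0 _] := nbr01 u v.
  (* An edge in no triangle contributes 0 on the right and [- a * t ^+ 2] on the left. *)
  have [c0|c0] := eqVneq (codeg u v) 0.
    have a0 : 0 <= a by lra.
    by rewrite c0 !mulr0 mul0r sub0r addr0 oppr_le0 !mulr_ge0 ?sqr_ge0.
  rewrite /f; move: (codeg u v) (nbr u v) c0 => x y x0.
  by rewrite le_eqVlt; apply/orP; left; apply/eqP; field.
rewrite big_split sumrB /= -!mulr_sumr reg -/(local_edges u) gE => le2.
apply: le_trans (lerD le2 le2); rewrite le_eqVlt aE.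
by apply/orP; left; apply/eqP; ring.
Qed.

Lemma eq_tsum (G : sgraph) (F F' : G -> G -> G -> R) :
  (forall u v w, F u v w = F' u v w) -> tsum F = tsum F'.
Proof.
by move=> FF; do 3!(apply: eq_bigr => ? _); rewrite FF.
Qed.

Lemma tsumD (G : sgraph) (F F' : G -> G -> G -> R) :
  tsum (fun u v w => F u v w + F' u v w) = tsum F + tsum F'.
Proof.
rewrite /tsum -big_split; apply: eq_bigr => u _; rewrite -big_split.
by apply: eq_bigr => v _; rewrite -big_split; apply: eq_bigr => w _; rewrite mulrDr.
Qed.

Lemma tsumZ (G : sgraph) (a : R) (F : G -> G -> G -> R) :
  tsum (fun u v w => a * F u v w) = a * tsum F.
Proof.
rewrite /tsum mulr_sumr; apply: eq_bigr => u _; rewrite mulr_sumr.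
by apply: eq_bigr => v _; rewrite mulr_sumr; apply: eq_bigr => w _; rewrite mulrCA.
Qed.

Lemma tsum12 (G : sgraph) (F : G -> G -> G -> R) :
  tsum (fun u v w => F v u w) = tsum F.
Proof.
rewrite /tsum exchange_big; apply: eq_bigr => v _; apply: eq_bigr => u _.
by apply: eq_bigr => w _; rewrite /triangle (nbrC u v) [_ * _ * nbr v w]mulrAC.
Qed.

Lemma tsum23 (G : sgraph) (F : G -> G -> G -> R) :
  tsum (fun u v w => F u w v) = tsum F.
Proof.
apply: eq_bigr => u _; rewrite exchange_big; apply: eq_bigr => w _.
by apply: eq_bigr => v _; rewrite /triangle (nbrC v w) (mulrC (nbr u v)).
Qed.

(** In the graph induced on N(u), where [codeg u v] is the degree of [v], both sides sum the product
    of the end degrees over the ordered edges. *)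
Lemma tsum_walks (G : sgraph) :
  tsum (fun u v _ : G => local_walks u v)
  = tsum (fun u v w : G => codeg u v * codeg u w).
Proof.
apply: eq_bigr => u _; rewrite triangle_sum; apply: eq_bigr => v _.
rewrite mulr_sumr; apply: eq_bigr => w _; rewrite /triangle; ring.
Qed.

(** This is [triangle_bound] summed over all ordered triangles. The six walk terms all have the sum
    [X] and total coefficient 16; the product of [codeg u w] and [codeg v w] takes away 2, which
    leaves the 14. *)
Lemma triangle_sum_bound (G : sgraph) (d : R) :
  regular_of G d -> K4_free G -> locally_dense G ->
  \sum_(u : G) (\sum_v \sum_w triangle u v w * (14 * codeg u v * codeg u w + codeg u v ^+ 2
     + codeg u w ^+ 2 - (10 * d - 4 * #|G|%:R) * (codeg u v + codeg u w))
    + local_edges u * (10 * d ^+ 2 - 5 * d * #|G|%:R + 4 / 9 * #|G|%:R ^+ 2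
                       - 7 * local_edges u)) <= 0.
Proof.
move=> reg K4 dns; set n := #|G|%:R; set b := 10 * d - 4 * n.
have T1 (h : G -> R) : tsum (fun u v w : G => h u) = \sum_u local_edges u * h u.
  apply: eq_bigr => u _; rewrite (triangle_sum u (fun=> h u)) /local_edges mulr_suml.
  by [].
pose X := tsum (fun u v w : G => codeg u v * codeg u w).
pose A := tsum (fun u v w : G => codeg u v).
pose A2 := tsum (fun u v w : G => codeg u v ^+ 2).
pose Y := tsum (fun u v w : G => local_edges u).
pose O := tsum (fun u v w : G => 1).
have XC : X = tsum (fun u v w : G => codeg u w * codeg v w).
  rewrite (tsum23 (fun u v w : G => codeg u v * codeg w v)).
  rewrite (tsum12 (fun u v w : G => codeg v u * codeg w u)).
  by apply: eq_tsum => u v w; rewrite (codegC v) (codegC w).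
have W1 : tsum (fun u v w : G => local_walks u v) = X by exact: tsum_walks.
have W2 : tsum (fun u v w : G => local_walks v u) = X by rewrite -W1 -tsum12.
have W3 : tsum (fun u v w : G => local_walks u w) = X by rewrite -W1 -tsum23.
have W4 : tsum (fun u v w : G => local_walks v w) = X by rewrite -W3 -tsum12.
have W5 : tsum (fun u v w : G => local_walks w u) = X by rewrite -W2 -tsum23.
have W6 : tsum (fun u v w : G => local_walks w v) = X by rewrite -W4 -tsum23.
have Y2 : tsum (fun u v w : G => local_edges v) = Y by rewrite /Y -tsum12.
have Y3 : tsum (fun u v w : G => local_edges w) = Y by rewrite -Y2 -tsum23.
have A3 : tsum (fun u v w : G => codeg u w) = A by rewrite /A -tsum23.
have A4 : tsum (fun u v w : G => codeg v w) = A by rewrite -A3 -tsum12.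
have A5 : tsum (fun u v w : G => codeg u w ^+ 2) = A2 by rewrite /A2 -tsum23.
have main : tsum (fun u v w : G => 2 * local_walks w u + (2 * local_walks w v
    + (4 * local_walks u v + (4 * local_walks v u + (2 * local_walks u w
    + (2 * local_walks v w + (- 1 * local_edges w + (- 3 * local_edges u
    + (- 3 * local_edges v + ((10 * d ^+ 2 - 4 * d * n) * 1
    + (- (12 * d - 4 * n) * codeg u v + (- (4 * d - 2 * n) * codeg u w
    + (- (4 * d - 2 * n) * codeg v w + (2 * codeg u v ^+ 2
    + - 2 * (codeg u w * codeg v w)))))))))))))))
    <= tsum (fun u v w : G => (n * d - 4 / 9 * n ^+ 2) * 1).
  apply: ler_sum => u _; apply: ler_sum => v _; apply: ler_sum => w _.
  have [->|tri0] := eqVneq (triangle u v w) 0; first by rewrite !mul0r.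
  have [uv uw vw] := triangle_adj tri0; apply: ler_wpM2l; first exact: triangle_ge0.
  have := triangle_bound reg K4 dns uv uw vw; rewrite -/n.
  move: (local_walks w u) (local_walks w v) (local_walks u v) (local_walks v u).
  move: (local_walks u w) (local_walks v w) (local_edges u) (local_edges v).
  move: (local_edges w) (codeg u v) (codeg u w) (codeg v w) => *; lra.
rewrite !tsumD !tsumZ W1 W2 W3 W4 W5 W6 Y2 Y3 A3 A4 -XC -/X -/Y -/A -/A2 -/O in main.
have FE : \sum_(u : G) \sum_v \sum_w triangle u v w * (14 * codeg u v * codeg u w + codeg u v ^+ 2
     + codeg u w ^+ 2 - b * (codeg u v + codeg u w)) = 14 * X + 2 * A2 - 2 * b * A.
  transitivity (tsum (fun u v w : G => 14 * (codeg u v * codeg u w)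
     + (codeg u v ^+ 2 + (codeg u w ^+ 2 + (- b * codeg u v + - b * codeg u w))))).
    by apply: eq_tsum => u v w; ring.
  by rewrite !tsumD !tsumZ A3 A5 -/X -/A -/A2; ring.
rewrite big_split /= FE.
have -> : \sum_(u : G) local_edges u * (10 * d ^+ 2 - 5 * d * n + 4 / 9 * n ^+ 2
    - 7 * local_edges u) = (10 * d ^+ 2 - 5 * d * n + 4 / 9 * n ^+ 2) * O - 7 * Y.
  rewrite /O /Y !T1 !mulr_sumr -sumrB; apply: eq_bigr => u _; ring.
rewrite /b; lra.
Qed.

(** * Lower bounds for the mean codegree at a vertex *)

(** The test vector is 1 on N(u) and -d / (n - d) elsewhere, so its sum is 0; the condition 2 d <= n
    keeps it above -1. *)
Lemma local_edges_small (G : sgraph) (d : R) (u : G) :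
  regular_of G d -> locally_dense G -> 0 < d -> 2 * d <= #|G|%:R ->
  22 * d ^+ 2 - 17 * d * #|G|%:R + 4 * #|G|%:R ^+ 2 <= 9 * local_edges u.
Proof.
move=> reg dns d0; have [n nE] : exists n, n = #|G|%:R :> R by exists #|G|%:R.
rewrite -nE => dn; pose a := n / (n - d); pose b := - d / (n - d).
have nd0 : n - d != 0 by lra.
pose y x := a * nbr u x + b * 1.
have a0 : 0 <= a by rewrite /a divr_ge0 //; lra.
have ab : a = 1 - b by rewrite /a /b; field.
have b0 : b <= 0 by rewrite /b mulNr oppr_le0 divr_ge0 //; lra.
have b1 : - 1 <= b by rewrite /b mulNr lerN2 ler_pdivrMr; lra.
have y01 x : -1 <= y x <= 1 by rewrite /y /nbr; case: adj => /=; lra.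
have y0 : \sum_x y x = 0.
  rewrite big_split /= -!mulr_sumr reg sum_const1 -nE /a /b.
  by field.
have := dense_signed reg dns y01 y0.
rewrite (@qform_sqr _ y (nbr u) (fun=> 1) a b) // !(qform_const _ reg) reg sum_const1 -nE.
rewrite qform_nbr -/(local_edges u); move: (local_edges u) => g.
have -> : a ^+ 2 * g + 2 * a * b * (d * d) + b ^+ 2 * (d * n)
   = (n * (n * g - d ^+ 3)) / (n - d) ^+ 2.
  by rewrite /a /b; field.
rewrite ler_pdivlMr ?exprn_gt0 //; last lra.
move=> le1; have n0 : 0 < n by lra.
have : n * (22 * d ^+ 2 - 17 * d * n + 4 * n ^+ 2) * n <= n * (9 * g) * n by lra.
by rewrite ler_pM2r // ler_pM2l.
Qed.

Lemma adj_ex (G : sgraph) (d : R) (u : G) :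
  regular_of G d -> 0 < d -> exists v, adj u v.
Proof.
move=> reg d0; case: (pickP (adj u)) => [v uv|no]; first by exists v.
by move: d0; rewrite -(reg u) big1 ?ltxx // => v _; rewrite /nbr no.
Qed.

(** The weight is 1 on N(u), lowered on the independent set N(u) \cap N(w) until the total is n/2. A
    good [w] exists on average: the deviations [local_walks u w - t * codeg u w] sum over N(u) to
    the sum of the squares [(codeg u w - t) ^+ 2]. *)
Lemma local_edges_large (G : sgraph) (d t : R) (u : G) :
  regular_of G d -> K4_free G -> locally_dense G -> local_edges u = d * t ->
  0 < d -> #|G|%:R <= 2 * d -> #|G|%:R ^+ 2 <= 9 * t * (#|G|%:R - d).
Proof.
move=> reg K4 dns gE d0; have [n nE] : exists n, n = #|G|%:R :> R by exists #|G|%:R.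
rewrite -nE => nd.
have walks : 0 <= \sum_w nbr u w * (local_walks u w - t * codeg u w).
  have -> : \sum_w nbr u w * (local_walks u w - t * codeg u w)
    = \sum_w nbr u w * (codeg u w - t) ^+ 2.
    rewrite (eq_bigr (fun w => nbr u w * local_walks u w - t * (nbr u w * codeg u w)));
      last by move=> w _; ring.
    rewrite [RHS](eq_bigr (fun w => nbr u w * codeg u w ^+ 2
      - 2 * t * (nbr u w * codeg u w) + t ^+ 2 * nbr u w)); last by move=> w _; ring.
    rewrite sumrB [RHS]big_split /= sumrB -!mulr_sumr reg -/(local_edges u) gE.
    have -> : \sum_w nbr u w * local_walks u w = \sum_w nbr u w * codeg u w ^+ 2.
      under eq_bigr do rewrite mulr_sumr.
      rewrite exchange_big /=; apply: eq_bigr => x _; rewrite expr2 mulrA.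
      rewrite -mulrA mulrCA mulr_suml; apply: eq_bigr => w _.
      by rewrite (nbrC w x); ring.
    ring.
  by apply: sumr_ge0 => w _; have /andP[? _] := nbr01 u w; rewrite mulr_ge0 ?sqr_ge0.
have [w uw lw] : exists2 w, adj u w & t * codeg u w <= local_walks u w.
  case: (pickP [pred w | adj u w && (t * codeg u w <= local_walks u w)]) => [w /andP[]|no].
    by exists w.
  have [v uv] := adj_ex u reg d0.
  suff : \sum_w nbr u w * (local_walks u w - t * codeg u w) < 0 by lra.
  have neg w : adj u w -> local_walks u w - t * codeg u w < 0.
    by move=> uw; have := no w; rewrite /= uw /= => /negbT; rewrite -ltNge subr_lt0.
  rewrite (bigD1 v) //= {1}/nbr uv mul1r ltr_wnDr ?neg //.
  apply: sumr_le0 => w _; rewrite /nbr; case uw : (adj u w); last by rewrite mul0r.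
  by rewrite mul1r ltW ?neg.
have c_ge := codeg_ge u w reg; rewrite -nE in c_ge.
(* If the codegree is 0, division yields [l = 0], which is right: [codeg_ge] then forces d = n/2. *)
pose l := (d - n / 2) / codeg u w.
have lc : l * codeg u w = d - n / 2.
  have [c0|c0] := eqVneq (codeg u w) 0; last by rewrite /l divfK.
  by rewrite c0 mulr0; lra.
have l0 : 0 <= l by rewrite divr_ge0 ?codeg_ge0 //; lra.
have l1 : l <= 1.
  have := codeg_ge0 u w; rewrite le_eqVlt => /orP[/eqP c0|c0].
    by rewrite /l -c0 invr0 mulr0 ler01.
  by rewrite ler_pdivrMr //; lra.
pose f x := 1 * nbr u x + - l * (nbr u x * nbr w x).
have f01 x : 0 <= f x <= 1.
  by rewrite /f /nbr; case: (adj u x); case: (adj w x) => /=; lra.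
have fsum : \sum_x f x = #|G|%:R / 2.
  by rewrite big_split /= -!mulr_sumr reg -/(codeg u w) mulNr lc -nE; field.
have := dns f f01 fsum.
rewrite (@qform_sqr _ f (nbr u) (fun x => nbr u x * nbr w x) 1 (- l)) //.
rewrite (codeg_indep K4 uw) (qformC (nbr u)) !qform_nbr -/(local_edges u).
rewrite -/(local_walks u w) gE -nE.
have : l * (t * codeg u w) <= l * local_walks u w by rewrite ler_wpM2l.
by rewrite mulrCA lc; lra.
Qed.

(** * Polynomial inequalities for the mean codegree *)

Lemma mean_codeg_large (n d t : R) : 0 < n -> n <= 2 * d -> 3 * d < 2 * n ->
  n ^+ 2 <= 9 * t * (n - d) ->
  3 * d <= 16 * t - (10 * d - 4 * n) /\
  0 < 16 * t ^+ 2 - 2 * (10 * d - 4 * n) * t - 7 * d * t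
      + 10 * d ^+ 2 - 5 * d * n + 4 / 9 * n ^+ 2.
Proof.
move=> n0 nd dn le_t; have s0 : 0 < n - d by lra.
(* [e] is the slack in the bound on [t]; both claims become polynomials in [e] with nonnegative
   coefficients. The constants 17/26, 35/54 and 7/12 are the minimisers of the quadratics in d/n. *)
pose e := 9 * t * (n - d) - n ^+ 2; have e0 : 0 <= e by rewrite subr_ge0.
have n20 : 0 < n ^+ 2 by rewrite exprn_gt0.
split.
  have := sqr_ge0 (d - 17 / 26 * n) => sq.
  have : 0 <= 16 * e + (117 * d ^+ 2 - 153 * d * n + 52 * n ^+ 2) by lra.
  have -> : 16 * e + (117 * d ^+ 2 - 153 * d * n + 52 * n ^+ 2)
    = 9 * (16 * t - (13 * d - 4 * n)) * (n - d) by rewrite /e; ring.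
  by rewrite pmulr_lge0 //; lra.
(* The factor (3 d - 2 n) ^ 2 reflects that the bound is tight exactly for the
   Turan graph. *)
rewrite -(pmulr_rgt0 _ (_ : 0 < 81 * (n - d) ^+ 2)); last first.
  by rewrite mulr_gt0 ?exprn_gt0.
set q := (X in 0 < X).
have -> : q = 16 * e ^+ 2 + e * (243 * d ^+ 2 - 315 * d * n + 104 * n ^+ 2)
   + (3 * d - 2 * n) ^+ 2 * (90 * d ^+ 2 - 105 * d * n + 31 * n ^+ 2).
  by rewrite /q /e; field.
have p1 : 0 <= 243 * d ^+ 2 - 315 * d * n + 104 * n ^+ 2.
  by have := sqr_ge0 (d - 35 / 54 * n); lra.
have p2 : 0 < 90 * d ^+ 2 - 105 * d * n + 31 * n ^+ 2.
  by have := sqr_ge0 (d - 7 / 12 * n); lra.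
have p3 : 0 < (3 * d - 2 * n) ^+ 2 by rewrite exprn_even_gt0 //=; lra.
have := mulr_ge0 e0 p1; have := mulr_gt0 p3 p2; have := sqr_ge0 e; lra.
Qed.

Lemma mean_codeg_small (n d t : R) : 0 < n -> 0 < d -> 2 * d <= n ->
  22 * d ^+ 2 - 17 * d * n + 4 * n ^+ 2 <= 9 * (d * t) ->
  3 * d <= 16 * t - (10 * d - 4 * n) /\
  0 < 16 * t ^+ 2 - 2 * (10 * d - 4 * n) * t - 7 * d * t
      + 10 * d ^+ 2 - 5 * d * n + 4 / 9 * n ^+ 2.
Proof.
move=> n0 d0 dn le_t.
pose e := 9 * (d * t) - (22 * d ^+ 2 - 17 * d * n + 4 * n ^+ 2).
have e0 : 0 <= e by rewrite subr_ge0.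
have n20 : 0 < n ^+ 2 by rewrite exprn_gt0.
split.
  have := sqr_ge0 (d - 118 / 235 * n) => sq.
  have : 0 <= 16 * e + (235 * d ^+ 2 - 236 * d * n + 64 * n ^+ 2) by lra.
  have -> : 16 * e + (235 * d ^+ 2 - 236 * d * n + 64 * n ^+ 2)
    = 9 * (16 * t - (13 * d - 4 * n)) * d by rewrite /e; ring.
  by rewrite pmulr_lge0 //; lra.
rewrite -(pmulr_rgt0 _ (_ : 0 < 81 * d ^+ 2)); last first.
  by rewrite mulr_gt0 ?exprn_gt0.
(* The part free of [e] is expanded around the end d = n/2 of the range, where it is n^4/4. *)
pose h := n / 2 - d; have h0 : 0 <= h by rewrite /h; lra.
set q := (X in 0 < X).
have -> : q = 16 * e ^+ 2 + e * (461 * d ^+ 2 - 472 * d * n + 128 * n ^+ 2)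
   + n ^+ 2 * (1 / 4 * n ^+ 2 - 5 / 2 * n * h + 105 * h ^+ 2)
   + h ^+ 2 * (h * (242 * n + 3208 * h)).
  by rewrite /q /e /h; field.
have p1 : 0 <= 461 * d ^+ 2 - 472 * d * n + 128 * n ^+ 2.
  by have := sqr_ge0 (d - 236 / 461 * n); lra.
have p2 : 0 < 1 / 4 * n ^+ 2 - 5 / 2 * n * h + 105 * h ^+ 2.
  by have := sqr_ge0 (h - 1 / 84 * n); lra.
have p3 : 0 <= h ^+ 2 * (h * (242 * n + 3208 * h)).
  by rewrite mulr_ge0 ?sqr_ge0 // mulr_ge0 //; lra.
have := mulr_ge0 e0 p1; have := mulr_gt0 n20 p2; have := sqr_ge0 e; lra.
Qed.

(** * The degree 2n/3 and the classes of non-adjacency *)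

(** If 3 d < 2 n, then [vertex_bound] and the bounds on the mean codegree make every summand of
    [triangle_sum_bound] positive. *)
Lemma degree_ge (G : sgraph) (d : R) (u : G) :
  regular_of G d -> K4_free G -> locally_dense G -> 2 * #|G|%:R <= 3 * d.
Proof.
move=> reg K4 dns; rewrite leNgt; apply/negP => dn.
have n0 : 0 < #|G|%:R :> R by rewrite ltr0n; apply/card_gt0P; exists u.
(* The zero test vector, that is, weight 1/2 everywhere, already bounds d away from 0. *)
have d_ge : 4 * #|G|%:R <= 9 * d.
  have z01 (x : G) : -1 <= (fun=> 0 : R) x <= 1 by lra.
  have := dense_signed reg dns z01; rewrite big1 // => /(_ erefl).
  have -> : @qform G (fun=> 0) (fun=> 0) = 0.
    by apply: big1 => x _; apply: big1 => y _; rewrite !mul0r.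
  have -> : 4 / 9 * #|G|%:R ^+ 2 - #|G|%:R * d = #|G|%:R * (4 / 9 * #|G|%:R - d) by ring.
  by clear z01; rewrite pmulr_rle0 //; lra.
have d0 : 0 < d by lra.
have small (v : G) := local_edges_small v reg dns d0.
have := triangle_sum_bound reg K4 dns; apply/negP; rewrite -ltNge (bigD1 u) //=.
have pos (v : G) : 0 < \sum_v0 \sum_w triangle v v0 w * (14 * codeg v v0 * codeg v w
     + codeg v v0 ^+ 2 + codeg v w ^+ 2
     - (10 * d - 4 * #|G|%:R) * (codeg v v0 + codeg v w))
    + local_edges v * (10 * d ^+ 2 - 5 * d * #|G|%:R + 4 / 9 * #|G|%:R ^+ 2
                       - 7 * local_edges v).
  have [t gE] : exists t, local_edges v = d * t.
    by exists (local_edges v / d); rewrite mulrC divfK //; lra.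
  have [t1 t2] : 3 * d <= 16 * t - (10 * d - 4 * #|G|%:R) /\
    0 < 16 * t ^+ 2 - 2 * (10 * d - 4 * #|G|%:R) * t - 7 * d * t
      + 10 * d ^+ 2 - 5 * d * #|G|%:R + 4 / 9 * #|G|%:R ^+ 2.
    have [le|/ltW le] := leP (2 * d) #|G|%:R.
      by apply: mean_codeg_small => //; rewrite -gE; apply: small.
    by apply: mean_codeg_large => //; apply: local_edges_large gE _ _.
  have t0 : 0 < t by lra.
  have := vertex_bound reg K4 gE d0 (ltW t0) t1.
  have := mulr_gt0 (mulr_gt0 d0 t0) t2; rewrite gE; lra.
by apply: lt_le_trans (pos u) _; rewrite lerDl sumr_ge0 // => v _; apply: ltW.
Qed.

Lemma codeg_ex (G : sgraph) (u v : G) :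
  0 < codeg u v -> exists2 w, adj u w & adj v w.
Proof.
move=> c0; case: (pickP [pred w | adj u w && adj v w]) => [w /andP[uw vw]|no].
  by exists w.
move: c0; rewrite /codeg big1 ?ltxx // => w _; have := no w; rewrite /= /nbr.
by case: (adj u w) => /= [->|_]; rewrite ?mulr0 ?mul0r.
Qed.

(** Otherwise 2 d > n, so there is a triangle; each vertex is adjacent to at most two of its
    corners, whence 3 d <= 2 n. *)
Lemma degree_le (G : sgraph) (d : R) (u : G) :
  regular_of G d -> K4_free G -> 3 * d <= 2 * #|G|%:R.
Proof.
move=> reg K4; rewrite leNgt; apply/negP => dn.
have n0 : 0 < #|G|%:R :> R by rewrite ltr0n; apply/card_gt0P; exists u.
have [v uv] : exists v, adj u v by apply: adj_ex reg _; lra.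
have [w uw vw] : exists2 w, adj u w & adj v w.
  by apply: codeg_ex; have := codeg_ge u v reg; lra.
have : \sum_x (nbr u x + nbr v x + nbr w x - 2 * 1) <= 0.
  apply: sumr_le0 => x _; have := K4_free_nbr x K4 uv uw vw.
  have := nbr01 u x; have := nbr01 v x; have := nbr01 w x; rewrite /nbr.
  by case: (adj u x); case: (adj v x); case: (adj w x) => /=; lra.
by rewrite sumrB !big_split /= -!mulr_sumr !reg sum_const1; lra.
Qed.

(* If y lies in a triangle y a b, then N(a) \cap N(b) is an independent set
   containing y, and by counting it contains every non-neighbour of y. *)
Lemma nonadj_trans (G : sgraph) (d : R) (x y z : G) :
  regular_of G d -> K4_free G -> 3 * d = 2 * #|G|%:R ->
  ~~ adj x y -> ~~ adj y z -> ~~ adj x z.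
Proof.
move=> reg K4 dn; rewrite adj_sym => yx yz.
have n0 : 0 < #|G|%:R :> R by rewrite ltr0n; apply/card_gt0P; exists x.
have [a ya] : exists a, adj y a by apply: adj_ex reg _; lra.
have [b yb ab] : exists2 b, adj y b & adj a b.
  by apply: codeg_ex; have := codeg_ge y a reg; lra.
have le0 q : 0 <= (1 - nbr y q) - nbr a q * nbr b q.
  have := K4_free_nbr q K4 ya yb ab; rewrite /nbr.
  by case: (adj y q); case: (adj a q); case: (adj b q) => /=; lra.
(* The sum is n - d - [codeg a b], which is at most 2 n - 3 d = 0. *)
have sum0 : \sum_q ((1 - nbr y q) - nbr a q * nbr b q) = 0.
  apply/eqP; rewrite eq_le sumr_ge0 ?andbT //.
  rewrite !sumrB sum_const1 reg -/(codeg a b).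
  by have := codeg_ge a b reg; lra.
have nonadj q : ~~ adj y q -> adj a q /\ adj b q.
  move/negPf=> yq; have := @psumr_eq0P _ _ predT _ (fun q _ => le0 q) sum0 q isT.
  rewrite /nbr yq; case: (adj a q); case: (adj b q) => //= /eqP.
  - by rewrite mulr0 !subr0 oner_eq0.
  - by rewrite mul0r !subr0 oner_eq0.
  - by rewrite mul0r !subr0 oner_eq0.
have [ax bx] := nonadj _ yx; have [az bz] := nonadj _ yz.
exact: (K4 a b x z).
Qed.

Lemma sum_nonadj (G : sgraph) (d : R) (u : G) :
  regular_of G d -> \sum_x (1 - nbr u x) = #|G|%:R - d.
Proof. by move=> reg; rewrite sumrB sum_const1 reg. Qed.

(** * Halves of the vertex set and the parity of the part size *)

Lemma card_half (k n : nat) (s : R) :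
  k%:R <= s -> s < k%:R + 1 -> s = n%:R / 2 -> k = (n %/ 2)%N.
Proof.
move=> ks sk sE; have : (k * 2 <= n)%N by rewrite -(ler_nat R) natrM; lra.
have : (n < k * 2 + 2)%N by rewrite -(ltr_nat R) natrD natrM; lra.
lia.
Qed.

Lemma dense_weights (G : sgraph) :
  (forall S : {set G}, #|S| = (#|G| %/ 2)%N ->
     #|G|%:R ^+ 2 / 18 <= (spanned_edges S)%:R :> R) ->
  locally_dense G.
Proof.
move=> dns w w01 sw; have [S [S1 S2 S3]] := round_weights w01.
have := dns S (card_half S1 S2 sw); have := spanned_edges_qform S; lra.
Qed.

(* If n = 3m is odd, the half consisting of one part and (m - 1) / 2 vertices of
   another spans only m (m - 1) / 2 edges. *)
Lemma turan_even (G : sgraph) (d : R) (m : nat) (u v : G) :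
  regular_of G d -> K4_free G -> 3 * d = 2 * #|G|%:R -> #|G| = (3 * m)%N ->
  adj u v ->
  (forall S : {set G}, #|S| = (#|G| %/ 2)%N ->
     #|G|%:R ^+ 2 / 18 <= (spanned_edges S)%:R :> R) ->
  ~~ odd m.
Proof.
move=> reg K4 dn nE uv dns; apply/negP => mo.
have m0 : 0 < m%:R :> R by rewrite ltr0n; case: (m) mo.
have n3 : #|G|%:R = 3 * m%:R :> R by rewrite nE natrM.
have indep (q : G) : qform (fun x => 1 - nbr q x) (fun x => 1 - nbr q x) = 0.
  apply: big1 => x _; apply: big1 => y _; rewrite /nbr.
  have [qx|qx] := boolP (adj q x); first by rewrite subrr !mul0r.
  have [qy|qy] := boolP (adj q y); first by rewrite subrr mulr0 mul0r.
  rewrite adj_sym in qx.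
  by rewrite (negPf (nonadj_trans reg K4 dn qx qy)) mulr0.
have nonadj (q : G) : \sum_x (1 - nbr q x) = m%:R by rewrite (sum_nonadj q reg); lra.
have c01 (q x : G) : 0 <= 1 - nbr q x <= 1 by have := nbr01 q x; lra.
(* Weight [l] on the part of [v] totals (m - 1) / 2, so [w] has the integral total (3 m - 1) / 2,
   the floor of n/2 for odd m. Rounding [w] then yields an actual half. *)
pose l : R := (m%:R - 1) / (2 * m%:R).
have lm : l * m%:R = (m%:R - 1) / 2 by rewrite /l; field; lra.
have m1 : 1 <= m%:R :> R by rewrite ler1n; case: (m) mo.
have l0 : 0 <= l by rewrite divr_ge0 //; lra.
have l1 : l <= 1 by rewrite ler_pdivrMr; lra.
pose w x := 1 * (1 - nbr u x) + l * (1 - nbr v x).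
have disj (x : G) : ~~ adj u x -> adj v x.
  move=> ux; apply: contraT => vx; rewrite adj_sym in vx.
  by have := nonadj_trans reg K4 dn ux vx; rewrite uv.
have w01 x : 0 <= w x <= 1.
  have := disj x; rewrite /w /nbr; case: (adj u x); case: (adj v x) => /=; first lra.
  - lra.
  - lra.
  - by move/(_ isT).
have sw : \sum_x w x = ((3 * m).-1)%:R / 2.
  rewrite big_split /= -!mulr_sumr !nonadj lm.
  have -> : ((3 * m).-1)%:R = 3 * m%:R - 1 :> R.
    by rewrite -subn1 natrB ?natrM //; case: (m) mo.
  by field.
have [S [S1 S2 S3]] := round_weights w01.
have /dns : #|S| = (#|G| %/ 2)%N by rewrite (card_half S1 S2 sw) nE; lia.
have := spanned_edges_qform S; move: S3.
rewrite (@qform_sqr _ w (fun x => 1 - nbr u x) (fun x => 1 - nbr v x) 1 l) // !indep.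
have p0 (q x : G) : 0 <= 1 - nbr q x by have /andP[] := c01 q x.
have := qform_le_mul (p0 u) (p0 v); rewrite !nonadj n3.
set e := qform _ _ => le_e.
have : l * e <= l * (m%:R * m%:R) by rewrite ler_wpM2l.
have -> : l * (m%:R * m%:R) = (m%:R - 1) / 2 * m%:R by rewrite mulrA lm.
have : 0 < m%:R * m%:R :> R by rewrite mulr_gt0.
lra.
Qed.

Lemma regular_of_degree (G : sgraph) (d : nat) :
  (forall x : G, degree x = d) -> regular_of G d%:R.
Proof.
move=> reg x; rewrite -(reg x) /degree -sum_indic; apply: eq_bigr => y _.
by rewrite /indic inE.
Qed.

End Weights.

(** * The isomorphism with the Turan graph *)

Lemma not_contains_K4 (G : sgraph) : ~ contains G (complete_graph 4) -> K4_free G.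
Proof.
move=> noK4 u v w x uv uw vw ux vx; apply/negP => wx; apply: noK4.
pose f (i : complete_graph 4) : G := nth u [:: u; v; w; x] (val (i : 'I_4)).
have fadj (i j : complete_graph 4) : adj i j -> adj (f i) (f j).
  case: i j => [[|[|[|[|i]]]] Hi] [[|[|[|[|j]]]] Hj] //= _; rewrite /f //=;
  by rewrite adj_sym.
exists f => // i j fij; apply/eqP; apply: contraT => ij.
have : adj (f i) (f j) by exact: fadj.
by rewrite fij adj_irrefl.
Qed.

(** The vertices of colour i are numbered i, i + r, i + 2 r, and so on, so that the residue mod [r]
    is the colour. *)
Lemma isomorphic_turan (G : sgraph) (r m : nat) (col : G -> nat) :
  (forall p, col p < r)%N ->
  (forall i, (i < r)%N -> #|[set q | col q == i]| = m) ->
  (forall p q, adj p q = (col p != col q)) ->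
  #|G| = (r * m)%N -> isomorphic G (turan r #|G|).
Proof.
move=> colr colm adjE nE.
pose cls p := enum [set q | col q == col p].
have clsP p : p \in cls p by rewrite mem_enum inE.
pose g p := (index p (cls p) * r + col p)%N.
have gn p : (g p < #|G|)%N.
  have : (index p (cls p) < m)%N.
    by rewrite -(colm _ (colr p)) cardE index_mem.
  rewrite nE /g => im; have := colr p.
  have : ((index p (cls p)).+1 * r <= m * r)%N by rewrite leq_mul2r im orbT.
  by rewrite mulSn; lia.
pose f p : turan r #|G| := Ordinal (gn p).
have gmod p : (g p %% r)%N = col p by rewrite /g modnMDl modn_small.
exists f; last by move=> p q; rewrite adjE /adj /= /multipartite_adj /= !gmod.
apply: inj_card_bij; last by rewrite card_ord.
move=> p q /(congr1 val) /= gpq.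
have cpq : col p = col q by rewrite -!gmod gpq.
have r0 : (0 < r)%N by exact: leq_ltn_trans (colr p).
move: gpq; rewrite /g cpq => /eqP; rewrite eqn_add2r eqn_pmul2r // => /eqP ipq.
have cE : cls p = cls q by rewrite /cls cpq.
by rewrite -(nth_index p (clsP p)) ipq cE nth_index.
Qed.

(** The corners of a triangle represent the classes: they are pairwise adjacent, and K4-freeness
    leaves every vertex non-adjacent to one of them. *)
Lemma complete_tripartite (G : sgraph) (m : nat) (u v w : G) :
  K4_free G -> (forall x y z : G, ~~ adj x y -> ~~ adj y z -> ~~ adj x z) ->
  (forall x : G, #|[set y | ~~ adj x y]| = m) -> #|G| = (3 * m)%N ->
  adj u v -> adj u w -> adj v w -> isomorphic G (turan 3 #|G|).
Proof.
move=> K4 trans cls nE uv uw vw.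
pose rep i := nth w [:: u; v] i.
pose col x := if ~~ adj u x then 0%N else if ~~ adj v x then 1%N else 2%N.
have repP x : ~~ adj (rep (col x)) x.
  rewrite /col; have [ux|//] := boolP (adj u x); have [vx|//] := boolP (adj v x).
  exact: (K4 u v w x).
have col3 x : (col x < 3)%N by rewrite /col; case: (adj u x); case: (adj v x).
have rep_inj i j : (i < 3)%N -> (j < 3)%N -> ~~ adj (rep i) (rep j) -> i = j.
  have [vu wu wv] : [/\ adj v u, adj w u & adj w v] by rewrite !(adj_sym _ u) (adj_sym w).
  by move: i j => [|[|[|i]]] [|[|[|j]]] //= _ _; rewrite /rep /= ?uv ?uw ?vw ?vu ?wu ?wv.
have colP x i : (i < 3)%N -> ~~ adj (rep i) x -> col x = i.
  move=> i3 ix; apply: rep_inj => //; apply: trans (repP x) _.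
  by rewrite adj_sym.
apply: (isomorphic_turan col3 _ _ nE) => [i i3|x y].
  rewrite -(cls (rep i)); apply: eq_card => x; rewrite !inE.
  by apply/eqP/idP => [<-|]; [exact: repP|exact: colP].
apply/idP/idP => [xy|]; last first.
  apply: contraR => xy; apply/eqP; apply: colP => //; apply: trans (repP y) _.
  by rewrite adj_sym.
apply: contraTneq xy => xy; have := repP y; rewrite -xy => cy.
by apply: trans cy; rewrite adj_sym.
Qed.

Close Scope ring_scope.

Theorem theorem1p3 (G : sgraph) (n : nat)
    (G_nonempty : 0 < #|G|)
    (G_order : #|G| = n)
    (G_K4_free : ~ contains G (complete_graph 4))
    (G_regular : regular G)
    (G_dense : forall S : {set G}, #|S| = n %/ 2 ->
       (n%:R ^+ 2 / 18%:R <= (spanned_edges S)%:R :> rat)%R) :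
  6 %| n /\ isomorphic G (turan 3 n).
Proof.
subst n; have [d degE] := G_regular; have /card_gt0P[u _] := G_nonempty.
have K4 := not_contains_K4 G_K4_free.
have reg := regular_of_degree rat degE.
have dns := dense_weights G_dense.
have dn : (3 * d = 2 * #|G|)%N.
  apply/eqP; rewrite -(eqr_nat rat) !natrM eq_le.
  by rewrite (degree_le u reg K4) (degree_ge u reg K4 dns).
have dnR : (3 * d%:R = 2 * #|G|%:R :> rat)%R by rewrite -!natrM dn.
have dR : (0 < d%:R :> rat)%R by rewrite ltr0n; lia.
have [v uv] := adj_ex u reg dR.
have [w uw vw] : exists2 w, adj u w & adj v w.
  apply: (@codeg_ex rat); apply: lt_le_trans (codeg_ge u v reg).
  by rewrite subr_gt0 -natrM ltr_nat; lia.
(* Each vertex has n - d = n/3 non-neighbours, itself included. *)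
pose m := (#|G| - d)%N; have nE : #|G| = (3 * m)%N by rewrite /m; lia.
have m_even : ~~ odd m by exact: turan_even reg K4 dnR nE uv G_dense.
split; first by rewrite nE -[6]/(3 * 2)%N dvdn_pmul2l // dvdn2.
apply: (complete_tripartite (m := m) K4 _ _ nE uv uw vw) => [x y z|x].
  exact: nonadj_trans reg K4 dnR.
rewrite /m -(degE x) /degree -(cardsC [set y | adj x y]) addKn.
by apply: eq_card => y; rewrite !inE.
Qed.
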